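(* Let $n,\ell\geq 1$ be integers and let $(T_{a,b}(u))_{(a,b,u)\in\Lambda}$ be a family of commuting variables satisfying the $T$-system $$T_{a,b}(u-1)\,T_{a,b}(u+1)=T_{a-1,b}(u)\,T_{a+1,b}(u)+T_{a,b+1}(u)\,T_{a,b-1}(u)$$ for all $a\in I$, $b\in J$, $u\in\mathbb{Z}$ with $(a,b,u+1)\in\Lambda$, with the spiral boundary conditions and the initial variables $X_{k,m}=T_{k,m}(k+m-2)$ described in the context (so that all $T_{a,b}(u)$ are regarded as elements of the field $K$ defined there). Then for any $(a,b,u)\in\Lambda$ one has the half-periodicity property $$T_{a,b}(u)=T_{n+1-a,\;\ell+1-b}(u+n+\ell+2).$$ Consequently $T_{a,b}(u)$ is $2(n+\ell+2)$-periodic in $u$, i.e. $T_{a,b}(u)=T_{a,b}(u+2(n+\ell+2))$ for all $(a,b,u)\in\Lambda$.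
   Context: Notation: $I=\{1,\dots,n\}$, $J=\{1,\dots,\ell\}$, $\Lambda=\{(a,b,u)\in I\times J\times\mathbb{Z}\mid a+b+u\in 2\mathbb{Z}\}$. Coefficients: $\mathcal{F}_1,\dots,\mathcal{F}_n$ are formal variables, and $\mathcal{F}_0=\mathcal{F}_{n+1}=1$. Ambient field and initial variables: $K=\mathbb{Q}(X_{k,m},\mathcal{F}_r\mid (k,m)\in I\times J,\ r\in I)$ is the field of rational functions in algebraically independent variables $X_{k,m}$ and $\mathcal{F}_r$. The $T_{a,b}(u)$ are elements of $K$ with $T_{k,m}(k+m-2)=X_{k,m}$ for $(k,m)\in I\times J$. Spiral boundary conditions: the terms $T_{0,m}(u)$, $T_{n+1,m}(u)$ (with $m\in J$), $T_{k,0}(u)$, $T_{k,\ell+1}(u)$ (with $k\in I$), for $u\in\mathbb{Z}$ such that the sum of the two indices and $u$ is even, are prescribed as follows. They depend on $u$ only modulo $2(\ell+n+2)$, so each is determined by the following values (the cases agree where they overlap): $$T_{n+1,m}(u)=\begin{cases}\mathcal{F}_{\frac{u+n+m+3}{2}} & \text{for } -n-3\leq u+m\leq n-1,\\ 1 & \text{for } 0\leq u+m-n+1\leq 2\ell+2,\end{cases}$$ $$T_{0,m}(u)=\begin{cases}\mathcal{F}_{\frac{u-m+2}{2}} & \text{for } -2\leq u-m\leq 2n,\\ 1 & \text{for } 0\leq u-m-2n\leq 2(\ell+1),\end{cases}$$ $$T_{k,\ell+1}(u)=\begin{cases}\mathcal{F}_{\frac{u-k-\ell+1}{2}} & \text{for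 } 0\leq u-\ell-k+1\leq 2n+2,\\ 1 & \text{for } \ell+1\leq u-2n-k\leq 3(\ell+1),\end{cases}$$ $$T_{k,0}(u)=\begin{cases}\mathcal{F}_{\frac{u+k+2}{2}} & \text{for } -2\leq u+k\leq 2n,\\ 1 & \text{for } 0\leq u-2n+k\leq 2(\ell+1).\end{cases}$$ In particular $T_{k,0}(k-2)=\mathcal{F}_k$. *)

(* Defs.v *)
From HB Require Import structures.
From mathcomp Require Import all_boot all_order all_algebra.
From mathcomp Require Import mpoly.

Set Implicit Arguments.
Unset Strict Implicit.
Unset Printing Implicit Defensive.

Import GRing.Theory Num.Theory.
Local Open Scope ring_scope.

(* One indeterminate per pair (k, m) in I x J (the X_{k,m}), and one per r in I
   (the F_r). Ordinals start at 0, so k : 'I_n stands for k.+1 in I. *)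
Definition indet (n l : nat) : finType := (('I_n * 'I_l) + 'I_n)%type.

Definition K (n l : nat) : fieldType :=
  {fraction {mpoly rat[#|{: indet n l}|]}}.

Definition gen n l (v : indet n l) : K n l := tofrac 'X_(enum_rank v).

Definition Xvar n l (k : 'I_n) (m : 'I_l) : K n l := gen (inl (k, m)).

(* F_r for 1 <= r <= n, and F_0 = F_{n+1} = 1; the value 1 at the remaining
   integers is never used. *)
Definition Fcoef n l (r : int) : K n l :=
  if r is Posz r'.+1 then
    if insub r' is Some i then gen (inr i : indet n l) else 1
  else 1.

Definition even_sum (a b : nat) (u : int) : bool :=
  (2 %| a%:Z + b%:Z + u)%Z.

Definition Lambda (n l a b : nat) (u : int) : bool :=
  [&& 1 <= a <= n, 1 <= b <= l & even_sum a b u]%N.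

Section TSystem.
Variables n l : nat.
(* T is a total function: only its values on Lambda and on the boundary, at
   points of the right parity, are constrained or used. *)
Implicit Type T : nat -> nat -> int -> K n l.

Definition T_system T : Prop :=
  forall (a b : nat) (u : int), Lambda n l a b (u + 1) ->
    T a b (u - 1) * T a b (u + 1) =
      T a.-1 b u * T a.+1 b u + T a b.+1 u * T a b.-1 u.

Definition initial_variables T : Prop :=
  forall (k : 'I_n) (m : 'I_l),
    T k.+1 m.+1 (k.+1%:Z + m.+1%:Z - 2) = Xvar k m.

Definition period : int := 2 * (l%:Z + n%:Z + 2).

Definition boundary_bottom T : Prop :=
  forall (m : nat) (u : int), (1 <= m <= l)%N -> even_sum n.+1 m u ->
  [/\ T n.+1 m (u + period) = T n.+1 m u,
      - n%:Z - 3 <= u + m%:Z <= n%:Z - 1 ->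
        T n.+1 m u = Fcoef n l ((u + n%:Z + m%:Z + 3) %/ 2)%Z
    & 0 <= u + m%:Z - n%:Z + 1 <= 2 * l%:Z + 2 ->
        T n.+1 m u = 1].

Definition boundary_top T : Prop :=
  forall (m : nat) (u : int), (1 <= m <= l)%N -> even_sum 0 m u ->
  [/\ T 0%N m (u + period) = T 0%N m u,
      - 2 <= u - m%:Z <= 2 * n%:Z ->
        T 0%N m u = Fcoef n l ((u - m%:Z + 2) %/ 2)%Z
    & 0 <= u - m%:Z - 2 * n%:Z <= 2 * (l%:Z + 1) ->
        T 0%N m u = 1].

Definition boundary_right T : Prop :=
  forall (k : nat) (u : int), (1 <= k <= n)%N -> even_sum k l.+1 u ->
  [/\ T k l.+1 (u + period) = T k l.+1 u,
      0 <= u - l%:Z - k%:Z + 1 <= 2 * n%:Z + 2 ->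
        T k l.+1 u = Fcoef n l ((u - k%:Z - l%:Z + 1) %/ 2)%Z
    & l%:Z + 1 <= u - 2 * n%:Z - k%:Z <= 3 * (l%:Z + 1) ->
        T k l.+1 u = 1].

Definition boundary_left T : Prop :=
  forall (k : nat) (u : int), (1 <= k <= n)%N -> even_sum k 0 u ->
  [/\ T k 0%N (u + period) = T k 0%N u,
      - 2 <= u + k%:Z <= 2 * n%:Z ->
        T k 0%N u = Fcoef n l ((u + k%:Z + 2) %/ 2)%Z
    & 0 <= u - 2 * n%:Z + k%:Z <= 2 * (l%:Z + 1) ->
        T k 0%N u = 1].

Definition spiral_boundary T : Prop :=
  [/\ boundary_bottom T, boundary_top T, boundary_right T & boundary_left T].

End TSystem.

(* Main.v *)
Require Import Defs.
From mathcomp Require Import all_boot all_order all_algebra.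
From mathcomp Require Import zify ring mpoly.

Set Implicit Arguments.
Unset Strict Implicit.
Unset Printing Implicit Defensive.

Import Order.TTheory GRing.Theory Num.Theory.
Local Open Scope ring_scope.

(** Put N = n + l + 2. The pattern T is a pattern of minors: there are vectors
    w_i (i an integer) in K^(n+1) with w_(i+N) = (-1)^n w_i and
      T a b u = det (w_p, ..., w_(p+n-a), w_q, ..., w_(q+a-1)),
    where p = (u + a - b)/2 + 1 and q = (u - a + b)/2 + n + 2. Replacing
    (a, b, u) by (n+1-a, l+1-b, u+N) replaces (p, q) by (q, p + N). It thus
    exchanges the two blocks and multiplies the vectors of one of them by
    (-1)^n, and the resulting signs cancel (bracket_rotate). This is the
    half-periodicity; applying it twice gives the period.

    It remains to find w. For every sequence w these minors satisfy the
    T-system, which becomes a three-term Plucker relation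
    (two_block_plucker). On the boundary one block is empty or the two blocks
    join, up to a rotation, so the boundary values are the consecutive minors
    det (w_r, ..., w_(r+n)), which are N-periodic in r; the spiral conditions
    prescribe exactly these. On the slice u = a + b - 2 one has p = a and
    q = n + 1 + b. With w_0, ..., w_n fixed, prescribing the slice gives for
    w_(n+l+1), ..., w_(n+1) successively triangular systems of linear
    equations, which are solvable because the prescribed values do not
    vanish (realization).

    Finally the system determines a pattern from its slice and its boundary
    (spread), provided that one can divide by the values that occur. They are
    subtraction-free expressions in the indeterminates, so they do not vanish
    (spiral_positive). *)

(** * Propagation from the initial slice *)

Section Spread.
Variables (n l : nat) (P : nat -> nat -> int -> Prop).
Hypothesis PT : forall b u, (1 <= b <= l)%N -> even_sum 0 b u -> P 0 b u.
Hypothesis PB : forall b u, (1 <= b <= l)%N -> even_sum n.+1 b u -> P n.+1 b u.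
Hypothesis PL : forall a u, (1 <= a <= n)%N -> even_sum a 0 u -> P a 0%N u.
Hypothesis PR : forall a u, (1 <= a <= n)%N -> even_sum a l.+1 u -> P a l.+1 u.
Hypothesis Pinit : forall a b, (1 <= a <= n)%N -> (1 <= b <= l)%N ->
  P a b (a%:Z + b%:Z - 2).
Hypothesis Pstep : forall a b u, Lambda n l a b (u + 1) -> P a b (u - 1) ->
  P a.-1 b u -> P a.+1 b u -> P a b.+1 u -> P a b.-1 u -> P a b (u + 1).

(** Outer induction on the level h, inner induction on a + b: at (a, b) the
    neighbours with larger indices lie on level h, those with smaller indices
    on level h + 1. *)
Lemma spread_forward a b h : (1 <= a <= n)%N -> (1 <= b <= l)%N ->
  P a b (a%:Z + b%:Z - 2 + 2 * h%:Z).
Proof.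
elim: h a b => [|h IHh] a b; first by rewrite mulr0 addr0; exact: Pinit.
have [s] := ubnP (a + b); elim: s a b => // s IHs a b sab Ia Ib.
have -> : a%:Z + b%:Z - 2 + 2 * h.+1%:Z
        = a%:Z + b%:Z - 1 + 2 * h%:Z + 1 by lia.
apply: Pstep.
- rewrite /Lambda /even_sum; lia.
- have -> : a%:Z + b%:Z - 1 + 2 * h%:Z - 1 = a%:Z + b%:Z - 2 + 2 * h%:Z by lia.
  exact: IHh.
- have [->|a1] := eqVneq a 1%N; first by apply: PT; rewrite // /even_sum; lia.
  have -> : a%:Z + b%:Z - 1 + 2 * h%:Z = a.-1%:Z + b%:Z - 2 + 2 * h.+1%:Z by lia.
  by apply: IHs; lia.
- have [->|an] := eqVneq a n; first by apply: PB; rewrite // /even_sum; lia.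
  have -> : a%:Z + b%:Z - 1 + 2 * h%:Z = a.+1%:Z + b%:Z - 2 + 2 * h%:Z by lia.
  by apply: IHh; lia.
- have [->|bl] := eqVneq b l; first by apply: PR; rewrite // /even_sum; lia.
  have -> : a%:Z + b%:Z - 1 + 2 * h%:Z = a%:Z + b.+1%:Z - 2 + 2 * h%:Z by lia.
  by apply: IHh; lia.
- have [->|b1] := eqVneq b 1%N; first by apply: PL; rewrite // /even_sum; lia.
  have -> : a%:Z + b%:Z - 1 + 2 * h%:Z = a%:Z + b.-1%:Z - 2 + 2 * h.+1%:Z by lia.
  by apply: IHs; lia.
Qed.
End Spread.

(** The order in which the system determines a pattern from the slice
    u = a + b - 2 and the boundary, as an induction principle. It is used for
    the nonvanishing of a pattern and for the equality of two patterns.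
    Rotating the rectangle by 180 degrees and reversing time preserves the
    system and the slice, which reduces the past to the future. *)
Lemma spread n l (P : nat -> nat -> int -> Prop) :
  (forall b u, (1 <= b <= l)%N -> even_sum 0 b u -> P 0 b u) ->
  (forall b u, (1 <= b <= l)%N -> even_sum n.+1 b u -> P n.+1 b u) ->
  (forall a u, (1 <= a <= n)%N -> even_sum a 0 u -> P a 0%N u) ->
  (forall a u, (1 <= a <= n)%N -> even_sum a l.+1 u -> P a l.+1 u) ->
  (forall a b, (1 <= a <= n)%N -> (1 <= b <= l)%N ->
     P a b (a%:Z + b%:Z - 2)) ->
  (forall a b u, Lambda n l a b (u + 1) ->
     P a.-1 b u -> P a.+1 b u -> P a b.+1 u -> P a b.-1 u ->
     P a b (u - 1) <-> P a b (u + 1)) ->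
  forall a b u, Lambda n l a b u -> P a b u.
Proof.
move=> PT PB PL PR Pinit Pstep a b u Lab.
have Pfwd a' b' h : (1 <= a' <= n)%N -> (1 <= b' <= l)%N ->
    P a' b' (a'%:Z + b'%:Z - 2 + 2 * h%:Z).
  apply: spread_forward => // a1 b1 u1 L1 P0 P1 P2 P3 P4.
  exact/(Pstep _ _ _ L1 P1 P2 P3 P4).
pose Q a b u := P (n.+1 - a)%N (l.+1 - b)%N (n%:Z + l%:Z - 2 - u).
have Qbwd : forall a b h, (1 <= a <= n)%N -> (1 <= b <= l)%N ->
    Q a b (a%:Z + b%:Z - 2 + 2 * h%:Z).
  apply: (@spread_forward n l Q); rewrite /Q.
  - by move=> b' u' b'l; rewrite subn0 /even_sum => ev; apply: PB; rewrite /even_sum; lia.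
  - by move=> b' u' b'l; rewrite subnn /even_sum => ev; apply: PT; rewrite /even_sum; lia.
  - by move=> b' u' b'l; rewrite subn0 /even_sum => ev; apply: PR; rewrite /even_sum; lia.
  - by move=> b' u' b'l; rewrite subnn /even_sum => ev; apply: PL; rewrite /even_sum; lia.
  - move=> a' b' a'n b'l.
    have -> : n%:Z + l%:Z - 2 - (a'%:Z + b'%:Z - 2)
            = (n.+1 - a')%N%:Z + (l.+1 - b')%N%:Z - 2 by lia.
    by apply: Pinit; lia.
  - move=> a' b' u' L' P0 P1 P2 P3 P4.
    have L0 := L'; rewrite /Lambda /even_sum in L0.
    have -> : n%:Z + l%:Z - 2 - (u' + 1) = n%:Z + l%:Z - 2 - u' - 1 by lia.
    apply/Pstep.
    + rewrite /Lambda /even_sum; lia.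
    + by move: P2; congr (P _ _ _); lia.
    + by move: P1; congr (P _ _ _); lia.
    + by move: P4; congr (P _ _ _); lia.
    + by move: P3; congr (P _ _ _); lia.
    + by move: P0; congr (P _ _ _); lia.
have /and3P[Ia Ib] := Lab; rewrite /even_sum => ev.
have [uge|ult] := lerP (a%:Z + b%:Z - 2) u.
  have -> : u = a%:Z + b%:Z - 2 + 2 * (`|((u - a%:Z - b%:Z + 2) %/ 2)%Z|%N)%:Z by lia.
  exact: Pfwd.
have := Qbwd (n.+1 - a)%N (l.+1 - b)%N (`|((a%:Z + b%:Z - 2 - u) %/ 2)%Z|%N).
rewrite /Q => QQ; have {QQ} := QQ _ _; move=> /(_ ltac:(lia) ltac:(lia)).
by congr (P _ _ _); lia.
Qed.

(** * Determinants of lists of vectors *)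

Lemma set_nth_size_cat (T : Type) (x0 x y : T) (s r : seq T) :
  set_nth x0 (s ++ y :: r) (size s) x = s ++ x :: r.
Proof. by elim: s => //= z s ->. Qed.

Section Bracket.
Variables (F : fieldType) (d : nat).
Implicit Types (s r A B : seq 'rV[F]_d) (x y z t : 'rV[F]_d).

(** The determinant is taken of a list, so that minors of consecutive vectors
    can be cut and glued by concatenation; it is meaningful for lists of
    length d. *)
Definition bracket s : F := \det (\matrix_(i < d) nth 0 s i).

Lemma bracket_cramer s x : size s = d ->
  bracket s *: x = \sum_(i < d) bracket (set_nth 0 s i x) *: nth 0 s i.
Proof.
move=> sz; pose M : 'M[F]_d := \matrix_(i < d) nth 0 s i.
have -> : bracket s *: x = x *m \adj M *m M.
  by rewrite -mulmxA mul_adj_mx mul_mx_scalar.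
rewrite mulmx_sum_row; apply: eq_bigr => i _; rewrite rowK; congr (_ *: _).
rewrite mxE /bracket (expand_det_row _ i); apply: eq_bigr => j _.
rewrite !mxE nth_set_nth /= eqxx; congr (_ * _).
rewrite /cofactor; congr (_ * \det _); apply/matrixP => i' j'.
rewrite !mxE nth_set_nth /= (_ : (lift i i' == i :> nat) = false) //.
by rewrite eq_sym; apply/negbTE/neq_lift.
Qed.

(** The column of coefficients of the linear form
    x |-> bracket (s ++ x :: r). *)
Definition bracket_form s r : 'cV[F]_d :=
  \col_j bracket (s ++ delta_mx 0 j :: r).

Lemma bracketE s x r : (size s < d)%N ->
  bracket (s ++ x :: r) = (x *m bracket_form s r) 0 0.
Proof.
move=> sd; pose i0 := Ordinal sd.
pose M y : 'M[F]_d := \matrix_(i < d) nth 0 (s ++ y :: r) i.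
have cofM y j : cofactor (M y) i0 j = cofactor (M 0) i0 j.
  rewrite /cofactor; congr (_ * \det _); apply/matrixP => i' j'.
  rewrite !mxE !nth_cat; case: ltnP => // ge; case e: (_ - _)%N => [|//].
  by have := neq_lift i0 i'; rewrite -val_eqE /=; move: ge e => /=; lia.
have expM y : bracket (s ++ y :: r) = \sum_j y 0 j * cofactor (M 0) i0 j.
  rewrite /bracket (expand_det_row _ i0); apply: eq_bigr => j _.
  by rewrite -/(M y) cofM !mxE nth_cat ltnn subnn.
rewrite expM mxE; apply: eq_bigr => j _; rewrite mxE expM; congr (_ * _).
rewrite (bigD1 j) //= mxE !eqxx mul1r big1 ?addr0 // => k kj.
by rewrite mxE (negPf kj) andbF mul0r.
Qed.

Lemma bracketZ s c x r : (size s < d)%N ->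
  bracket (s ++ c *: x :: r) = c * bracket (s ++ x :: r).
Proof. by move=> sd; rewrite !bracketE // -scalemxAl mxE. Qed.

Lemma bracketD s x y r : (size s < d)%N ->
  bracket (s ++ x + y :: r) = bracket (s ++ x :: r) + bracket (s ++ y :: r).
Proof. by move=> sd; rewrite !bracketE // mulmxDl mxE. Qed.

Lemma bracket_repeat s x r q : size (s ++ x :: r ++ x :: q) = d ->
  bracket (s ++ x :: r ++ x :: q) = 0.
Proof.
rewrite size_cat /= size_cat /= => sz.
have lt1 : (size s < d)%N by lia.
have lt2 : (size s + (size r).+1 < d)%N by lia.
apply: (@determinant_alternate _ _ _ (Ordinal lt1) (Ordinal lt2)).
  by rewrite -val_eqE /=; lia.
move=> j; rewrite !mxE /= !nth_cat ltnn subnn.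
have -> : (size s + (size r).+1 < size s)%N = false by lia.
by rewrite addKn /= nth_cat ltnn subnn.
Qed.

Lemma bracket_mem x r : x \in r -> (size r).+1 = d -> bracket (x :: r) = 0.
Proof. by case/splitPr => p q sz; apply: (@bracket_repeat [::]). Qed.

(** Polarization: the bracket vanishes when x + y occupies both places. *)
Lemma bracket_swap s x y r : size (s ++ x :: y :: r) = d ->
  bracket (s ++ x :: y :: r) = - bracket (s ++ y :: x :: r).
Proof.
move=> sz; have sz' := sz; rewrite size_cat /= in sz'.
have B0 z : bracket (s ++ z :: z :: r) = 0.
  by apply: (@bracket_repeat s z [::]); rewrite size_cat.
have B1 z t t' : bracket (s ++ z :: t + t' :: r)
    = bracket (s ++ z :: t :: r) + bracket (s ++ z :: t' :: r).
  by rewrite -!(cat_rcons z) bracketD // size_rcons; lia.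
have := B0 (x + y); rewrite bracketD ?B1; last by lia.
by rewrite !B0 add0r addr0 => /eqP; rewrite addr_eq0 => /eqP.
Qed.

Lemma bracket_front s A x r : size (s ++ A ++ x :: r) = d ->
  bracket (s ++ A ++ x :: r) = (-1) ^+ size A * bracket (s ++ x :: A ++ r).
Proof.
elim: A s => [|y A IH] s sz; first by rewrite mul1r.
rewrite /= -cat_rcons IH cat_rcons //.
rewrite bracket_swap ?exprS ?mulN1r ?mulrN ?mulNr //.
by move: sz; rewrite !size_cat /= !size_cat /=; lia.
Qed.

Lemma bracket_catC s A B r : size (s ++ A ++ B ++ r) = d ->
  bracket (s ++ A ++ B ++ r)
    = (-1) ^+ (size A * size B) * bracket (s ++ B ++ A ++ r).
Proof.
elim: B s => [|y B IH] s sz; first by rewrite muln0 mul1r.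
rewrite /= bracket_front // -[s ++ y :: _]cat_rcons IH.
  by rewrite cat_rcons mulrA -exprD mulnS.
by move: sz; rewrite !size_cat /= size_rcons /=; lia.
Qed.

Lemma bracket_catZ s c A r : (size (s ++ A ++ r) <= d)%N ->
  bracket (s ++ map ( *:%R c) A ++ r) = c ^+ size A * bracket (s ++ A ++ r).
Proof.
elim: A s => [|y A IH] s sz; first by rewrite mul1r.
rewrite /= bracketZ; last by move: sz; rewrite size_cat /=; lia.
rewrite -!(cat_rcons y) IH; first by rewrite mulrA -exprS.
by rewrite cat_rcons.
Qed.

(** Apply the linear form y |-> bracket (y :: r) to Cramer's expansion of x
    along s. *)
Lemma bracket_plucker s x r : size s = d -> (0 < d)%N ->
  bracket s * bracket (x :: r) =
    \sum_(i < d) bracket (set_nth 0 s i x) * bracket (nth 0 s i :: r).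
Proof.
move=> sz d0; have E y := @bracketE [::] y r d0.
rewrite /= in E.
transitivity ((bracket s *: x *m bracket_form [::] r) 0 0).
  by rewrite -scalemxAl mxE E.
rewrite bracket_cramer // mulmx_suml summxE; apply: eq_bigr => i _.
by rewrite -scalemxAl mxE E.
Qed.

(** In the general relation for the list A ++ y :: z :: B only the exchanges
    of x with y and with z survive, because the other brackets repeat a vector
    of A or B. The signs from moving vectors across A cancel in pairs, and
    the one from exchanging x and y moves a product to the other side. *)
Lemma bracket_plucker3 A B x y z t : (size A + size B).+2 = d ->
  bracket (x :: A ++ z :: B) * bracket (A ++ y :: B ++ [:: t]) =
    bracket (x :: A ++ y :: B) * bracket (A ++ z :: B ++ [:: t])
    + bracket (x :: A ++ B ++ [:: t]) * bracket (A ++ y :: z :: B).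
Proof.
move=> sz.
have szs : size (A ++ y :: z :: B) = d by rewrite size_cat /=; lia.
have d0 : (0 < d)%N by lia.
have lt1 : (size A < d)%N by lia.
have lt2 : ((size A).+1 < d)%N by lia.
have := bracket_plucker x (A ++ B ++ [:: t]) szs d0.
rewrite (bigD1 (Ordinal lt1)) //= (bigD1 (Ordinal lt2)) /=; last first.
  by rewrite -val_eqE /=; lia.
rewrite big1 ?addr0; last first.
  move=> i /andP[]; rewrite -!val_eqE /= => i1 i2.
  rewrite (@bracket_mem (nth _ _ _)) ?mulr0 //; last by rewrite !size_cat /=; lia.
  rewrite catA mem_cat mem_cat nth_cat; case: ltnP => iA; first by rewrite mem_nth.
  case e: (i - size A)%N => [|[|k]]; [lia|lia|].
  have kB : (k < size B)%N by have := ltn_ord i; lia.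
  by rewrite /= (mem_nth _ kB) orbT.
rewrite -[X in set_nth _ X _.+1]cat_rcons -[X in nth _ X _.+1]cat_rcons.
rewrite -(size_rcons A y) !set_nth_size_cat !nth_cat !ltnn !subnn /= cat_rcons.
have front D u v : size (D ++ u :: v) = d ->
    bracket (u :: D ++ v) = (-1) ^+ size D * bracket (D ++ u :: v).
  move=> szD; rewrite (@bracket_front [::] D u v) //= mulrA -expr2 sqrr_sign.
  by rewrite mul1r.
have fr1 u v : bracket (u :: A ++ v :: B) = (-1) ^+ size A * bracket (A ++ u :: v :: B).
  by apply: front; rewrite size_cat /=; lia.
have fr2 u : bracket (u :: A ++ B ++ [:: t])
    = (-1) ^+ size A * bracket (A ++ u :: B ++ [:: t]).
  by apply: front; rewrite !size_cat /= size_cat /=; lia.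
have sw : bracket (A ++ y :: x :: B) = - bracket (A ++ x :: y :: B).
  by apply: bracket_swap; rewrite size_cat /=; lia.
rewrite !fr2 !fr1 sw => H; rewrite [X in _ + X]mulrC H.
have := sqrr_sign F (size A); set e := (-1) ^+ _ => e2.
ring: e2.
Qed.
End Bracket.

(** Moving A past B costs (-1)^(|A||B|) and the twist costs (-1)^(n|A|). Since
    |A| + |B| = n + 1, one of |A| and n + |B| is even. *)
Lemma bracket_rotate (F : fieldType) n (A B : seq 'rV[F]_n.+1) :
  (size A + size B = n.+1)%N ->
  bracket (B ++ map ( *:%R ((-1) ^+ n)) A) = bracket (A ++ B).
Proof.
move=> sz; have := @bracket_catZ F n.+1 B ((-1) ^+ n) A [::].
rewrite !cats0 => ->; last by rewrite size_cat; lia.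
have := @bracket_catC F n.+1 [::] B A [::].
rewrite /= !cats0 => ->; last by rewrite size_cat; lia.
rewrite mulrA -exprM -exprD -signr_odd.
suff -> : odd (n * size A + size B * size A) = false by rewrite mul1r.
have : odd (size A + size B) = odd n.+1 by rewrite sz.
rewrite oddD /= oddD !oddM.
by case: (odd n); case: (odd (size A)); case: (odd (size B)).
Qed.

(** * Vectors with prescribed brackets *)

Lemma exists_bracket (F : fieldType) n (x : F) :
  exists2 E : seq 'rV[F]_n.+1, size E = n.+1 & bracket E = x.
Proof.
pose M : 'M[F]_n.+1 := diag_mx (\row_j (if j == 0 then x else 1)).
exists [seq row i M | i : 'I_n.+1]; first by rewrite size_map size_enum_ord.
rewrite /bracket; have -> : \matrix_(i < n.+1) nth 0 [seq row i M | i : 'I_n.+1] i = M.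
  apply/row_matrixP => i; rewrite rowK (nth_map i) ?size_enum_ord //.
  by rewrite nth_ord_enum.
by rewrite det_diag big_ord_recl big1 ?mulr1 => [|i _]; rewrite mxE.
Qed.

Section Build.
Variables (F : fieldType) (d : nat).
Implicit Types (E s t : seq 'rV[F]_d).

(** These are d linear equations for v. In the basis E their matrix is
    triangular, because E_r with r > a already occurs in drop a.+1 E, and its
    diagonal entries are, up to sign, the brackets assumed to be nonzero. *)
Lemma bracket_solve E t (g : nat -> F) : size E = d -> (d <= size t)%N ->
  (forall a, (a < d)%N -> bracket (drop a E ++ take a t) != 0) ->
  exists v, forall a, (a < d)%N ->
    bracket (drop a.+1 E ++ v :: take a t) = g a.
Proof.
move=> szE szt nz.
pose Phi : 'M[F]_d :=
  \matrix_(j, a) bracket_form (drop a.+1 E) (take a t) j 0.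
have PhiE k (X : 'M[F]_(k, d)) i (a : 'I_d) :
    (X *m Phi) i a = bracket (drop a.+1 E ++ row i X :: take a t).
  rewrite bracketE ?size_drop ?mxE; last by have := ltn_ord a; lia.
  by apply: eq_bigr => j _; rewrite !mxE.
pose M : 'M[F]_d := \matrix_(i < d) nth 0 E i.
have unitPhi : Phi \in unitmx.
  suff : \det (M *m Phi)^T != 0.
    by rewrite det_tr det_mulmx mulf_eq0 negb_or unitmxE unitfE => /andP[].
  rewrite det_trig.
    apply/prodf_neq0 => a _; rewrite mxE PhiE rowK.
    have := @bracket_front F d [::] (drop a.+1 E) (nth 0 E a) (take a t) => /= Ef.
    rewrite Ef ?mulf_neq0 ?signr_eq0 //.
      by rewrite -cat_cons -drop_nth ?szE // nz.
    by have := ltn_ord a; rewrite size_cat /= size_drop szE size_take_min; lia.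
  apply/is_trig_mxP => a r ar; rewrite mxE PhiE rowK.
  have : nth 0 E r \in drop a.+1 E.
    have -> : r = (a.+1 + (r - a.+1))%N :> nat by lia.
    by rewrite -nth_drop mem_nth // size_drop szE; have := ltn_ord r; lia.
  have : size (drop a.+1 E ++ nth 0 E r :: take a t) = d.
    by have := ltn_ord a; rewrite size_cat /= size_drop szE size_take_min; lia.
  move=> sz /splitPr E'; case: E' sz => p q; rewrite -catA /= => sz.
  by rewrite bracket_repeat.
exists ((\row_(a < d) g a) *m invmx Phi) => a ad.
have := PhiE _ ((\row_(a < d) g a) *m invmx Phi) 0 (Ordinal ad).
rewrite mulmxKV // mxE /= => ->; congr (bracket (_ ++ _ :: _)).
by apply/rowP => j; rewrite [RHS]mxE.
Qed.

(** Adds m vectors in front of t one at a time, each one found by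
    bracket_solve; h r lists the brackets prescribed when r of the new vectors
    precede t. *)
Lemma bracket_build E t (h : nat -> nat -> F) m : size E = d -> (d <= size t)%N ->
  (forall a, (a <= d)%N -> bracket (drop a E ++ take a t) = h 0%N a) ->
  (forall r, h r 0%N = bracket E) ->
  (forall r a, (r <= m)%N -> (a <= d)%N -> h r a != 0) ->
  exists2 s, size s = m & forall k a, (k <= m)%N -> (a <= d)%N ->
    bracket (drop a E ++ take a (drop k s ++ t)) = h (m - k)%N a.
Proof.
move=> szE szt h0 hE; elim: m => [|m IHm] hnz.
  by exists [::] => // -[|//] a _ ad; rewrite h0.
have [s szs sP] := IHm (fun r a rm => hnz r a (leqW rm)).
have [|a ad|v vP] := @bracket_solve E (s ++ t) (fun a => h m.+1 a.+1) szE.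
- by rewrite size_cat; lia.
- by have := sP 0%N a isT (ltnW ad); rewrite drop0 => ->; rewrite subn0 hnz // ltnW.
exists (v :: s) => [|[|k] a km ad]; first by rewrite /= szs.
  case: a ad => [|a] ad; first by rewrite drop0 take0 cats0 hE.
  by rewrite drop0 /= vP.
by rewrite /= sP.
Qed.
End Build.

(** * Minors of two blocks of consecutive vectors *)

Section Window.
Variables (V : Type) (w : int -> V).
Definition window (p : int) (k : nat) : seq V := mkseq (fun i => w (p + i%:Z)) k.

Lemma size_window p k : size (window p k) = k.
Proof. exact: size_mkseq. Qed.

Lemma window_cat p k1 k2 : window p (k1 + k2) = window p k1 ++ window (p + k1%:Z) k2.
Proof.
rewrite /window /mkseq iotaD map_cat; congr (_ ++ _).
rewrite add0n -[X in iota X _]addn0 iotaDl -map_comp; apply: eq_map => i /=.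
by rewrite PoszD addrA.
Qed.

Lemma window1 p : window p 1 = [:: w p].
Proof. by congr [:: w _]; lia. Qed.

Lemma windowS p k : window p k.+1 = w p :: window (p + 1) k.
Proof. by rewrite -add1n window_cat window1. Qed.

Lemma windowSr p k : window p k.+1 = window p k ++ [:: w (p + k%:Z)].
Proof. by rewrite -addn1 window_cat window1. Qed.
End Window.

Section Quasi.
Variables (F : fieldType) (n N : nat) (w : int -> 'rV[F]_n.+1).
Hypothesis wN : forall i, w (i + N%:Z) = (-1) ^+ n *: w i.

Lemma window_quasi p k : window w (p + N%:Z) k = map ( *:%R ((-1) ^+ n)) (window w p k).
Proof.
by rewrite /window /mkseq -map_comp; apply: eq_map => i /=; rewrite addrAC wN.
Qed.

Definition two_block p q a := bracket (window w p (n.+1 - a) ++ window w q a).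

(** Let A and B be the parts common to all windows involved. The six brackets
    are the pairings of the extra vectors x = w p, y = w (p + n + 1 - a),
    z = w q and t = w (q + a), in the order x, A, y, z, B, t. *)
Lemma two_block_plucker p q a : (1 <= a <= n)%N ->
  two_block p q a * two_block (p + 1) (q + 1) a =
    two_block p (q + 1) a.-1 * two_block (p + 1) q a.+1
    + two_block p (q + 1) a * two_block (p + 1) q a.
Proof.
case: a => // a /= an.
rewrite /two_block.
have -> : (n.+1 - a)%N = (n - a.+1).+2 by lia.
have -> : (n.+1 - a.+1)%N = (n - a.+1).+1 by lia.
have -> : (n.+1 - a.+2)%N = (n - a.+1)%N by lia.
rewrite (windowS _ p (n - a.+1).+1) (windowS _ p (n - a.+1)) (windowS _ q a.+1).
rewrite (windowS _ q a) !windowSr /= -!catA /=.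
by apply: bracket_plucker3; rewrite !size_window; lia.
Qed.

Lemma two_block_rotate p q a : (a <= n.+1)%N ->
  two_block q (p + N%:Z) (n.+1 - a) = two_block p q a.
Proof.
move=> an; rewrite /two_block subKn // window_quasi bracket_rotate //.
by rewrite !size_window; lia.
Qed.

Lemma two_block_contiguous p a : (a <= n.+1)%N ->
  two_block p (p + (n.+1 - a)%N%:Z) a = bracket (window w p n.+1).
Proof. by move=> an; rewrite /two_block -window_cat subnK. Qed.

Lemma consecutive_periodic p :
  bracket (window w (p + N%:Z) n.+1) = bracket (window w p n.+1).
Proof.
have sz : (size (window w p n.+1) + size (@nil 'rV[F]_n.+1) = n.+1)%N.
  by rewrite size_window addn0.
by have := bracket_rotate sz; rewrite cats0 window_quasi.
Qed.
End Quasi.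

(** The vectors w_0, ..., w_n form a basis whose bracket is g 0 0. The l + 1
    vectors w_(n+1), ..., w_(n+l+1) are found from right to left by
    bracket_build, starting in front of the twisted copies
    w_(N+i) = (-1)^n w_i of the basis, where N = n + l + 2. *)
Lemma realization (F : fieldType) n l (g : nat -> nat -> F) :
  (forall b, g 0%N b = g 0%N 0%N) ->
  (forall a, (a <= n.+1)%N -> g a l.+1 = g 0%N 0%N) ->
  (forall a b, (a <= n.+1)%N -> (b <= l.+1)%N -> g a b != 0) ->
  exists w : int -> 'rV[F]_n.+1,
    (forall i, w (i + (n + l + 2)%N%:Z) = (-1) ^+ n *: w i) /\
    (forall a b, (a <= n.+1)%N -> (b <= l.+1)%N ->
       two_block w a (n.+1 + b)%N a = g a b).
Proof.
move=> g0 gl gnz; set N := (n + l + 2)%N.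
have [E szE brE] := exists_bracket n (g 0%N 0%N).
pose eps : F := (-1) ^+ n; pose t := map ( *:%R eps) E.
have szt : size t = n.+1 by rewrite size_map.
have [||r|r a rm ad|s szs sP] := @bracket_build F _ E t
  (fun r a => g a (l.+1 - r)%N) l.+1 szE.
- by rewrite szt.
- move=> a ad; rewrite subn0 gl // -brE -map_take bracket_rotate ?cat_take_drop //.
  by rewrite size_takel ?size_drop szE // subnKC.
- by rewrite g0 brE.
- by apply: gnz => //; lia.
(* absz loses the sign of the quotient, but eps only sees its parity. *)
pose w (i : int) : 'rV[F]_n.+1 :=
  eps ^+ `|(i %/ N%:Z)%Z| *: nth 0 (E ++ s) `|(i %% N%:Z)%Z|.
have szV : size (E ++ s) = N by rewrite size_cat szE szs /N; lia.
have N0 : N%:Z != 0 by rewrite /N; lia.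
have epsE : eps * eps = 1 by rewrite -expr2 sqrr_sign.
have wN i : w (i + N%:Z) = eps *: w i.
  rewrite /w -[X in i + X]mul1r addrC divzMDl // modzMDl scalerA addrC; congr (_ *: _).
  case: (i %/ _)%Z => [q|[|q]] /=; first by rewrite addn1 exprS.
    by rewrite epsE.
  by rewrite subn1 [in RHS]exprS mulrA epsE mul1r.
have wE (i : nat) : (i < N + n.+1)%N -> w i%:Z = nth 0 (E ++ s ++ t) i.
  rewrite catA nth_cat szV; case: (ltnP i N) => [iN _ | Ni iN].
    have iN' : 0 <= i%:Z < `|N%:Z|%N by rewrite /=; lia.
    by rewrite /w divz_small ?modz_small // scale1r.
  have -> : i%:Z = (i - N)%N%:Z + N%:Z by lia.
  have iE : (i - N < size E)%N by rewrite szE; lia.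
  have iN' : 0 <= (i - N)%N%:Z < `|N%:Z|%N by rewrite /=; lia.
  rewrite wN /w divz_small ?modz_small //.
  by rewrite /= scale1r nth_cat iE (nth_map 0).
have windowE (p k : nat) : (p + k <= N + n.+1)%N ->
    window w p k = take k (drop p (E ++ s ++ t)).
  move=> pk; have sz : size (take k (drop p (E ++ s ++ t))) = k.
    by rewrite size_takel // size_drop catA size_cat szV szt; lia.
  apply: (@eq_from_nth _ 0) => [|i]; first by rewrite size_window sz.
  rewrite size_window => ik; rewrite nth_mkseq // nth_take // nth_drop.
  by rewrite -PoszD wE //; lia.
exists w; split=> // a b an bl.
have := sP b a bl an; rewrite subKn // => <-.
rewrite /two_block !windowE /N; [|lia|lia].
rewrite drop_cat szE; congr (bracket (_ ++ _)).
  case: ltnP => an'; first by rewrite take_size_cat // size_drop szE.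
  have -> : (n.+1 - a)%N = 0%N by lia.
  by rewrite take0 drop_oversize // szE.
rewrite drop_cat szE ifF; last by lia.
rewrite addKn drop_cat szs; case: ltnP => // lb.
have -> : b = l.+1 by lia.
by rewrite subnn drop0 drop_oversize // szs.
Qed.

(** * Patterns with cyclic boundary values *)

Lemma periodic_modz (V : Type) (f : int -> V) (N : int) :
  (forall i, f (i + N) = f i) -> forall i, f i = f (i %% N)%Z.
Proof.
move=> fN i; rewrite {1}(divz_eq i N) addrC.
have up (k : nat) j : f (j + k%:Z * N) = f j.
  elim: k j => [|k IHk] j; first by rewrite mul0r addr0.
  by rewrite -[RHS]IHk -[RHS]fN; congr f; rewrite -addn1 PoszD; ring.
case: (i %/ N)%Z => k; first exact: up.
by rewrite -[LHS](up k.+1) NegzE mulNr subrK.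
Qed.

Section HalfPeriod.
Variables (F : fieldType) (n l : nat) (c : int -> F).
Variable T : nat -> nat -> int -> F.
Let N : int := (n + l + 2)%N%:Z.
Hypothesis cN : forall i, c (i + N) = c i.
Hypothesis c_neq0 : forall i, c i != 0.
Hypothesis T_neq0 : forall a b u, Lambda n l a b u -> T a b u != 0.
Hypothesis Tsys : forall a b u, Lambda n l a b (u + 1) ->
  T a b (u - 1) * T a b (u + 1) =
    T a.-1 b u * T a.+1 b u + T a b.+1 u * T a b.-1 u.
Hypothesis Ttop : forall b u, (1 <= b <= l)%N -> even_sum 0 b u ->
  T 0 b u = c ((u - b%:Z + 2) %/ 2)%Z.
Hypothesis Tbot : forall b u, (1 <= b <= l)%N -> even_sum n.+1 b u ->
  T n.+1 b u = c ((u + n%:Z + b%:Z + 3) %/ 2)%Z.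
Hypothesis Tleft : forall a u, (1 <= a <= n)%N -> even_sum a 0 u ->
  T a 0%N u = c ((u + a%:Z + 2) %/ 2)%Z.
Hypothesis Tright : forall a u, (1 <= a <= n)%N -> even_sum a l.+1 u ->
  T a l.+1 u = c ((u - a%:Z - l%:Z + 1) %/ 2)%Z.

(** The first values of the pattern of minors. On the sides of the rectangle
    [0, n+1] x [0, l+1] they are the consecutive minors that the boundary
    demands, and the corners continue the sides. *)
Definition slice a b : F :=
  if (1 <= a <= n)%N && (1 <= b <= l)%N then T a b (a%:Z + b%:Z - 2)
  else if b == 0%N then c a%:Z
  else if a == n.+1 then c (n.+1 + b)%N%:Z else c 0.

(** Two blocks of n + 1 - a and a consecutive vectors separated by b vectors;
    u moves both blocks along the sequence. *)
Definition minor_pattern (w : int -> 'rV[F]_n.+1) a b u : F :=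
  two_block w (((u + a%:Z - b%:Z) %/ 2)%Z + 1)
              (((u - a%:Z + b%:Z) %/ 2)%Z + n%:Z + 2) a.

(** Take w with the minors of T on the slice. Every consecutive minor of w
    belongs to one side of the slice, up to periodicity, hence is given by c,
    and on the boundary a pattern of minors consists of consecutive minors. So
    the two patterns agree on the slice and on the boundary, and therefore
    everywhere, as the values of T are nonzero. *)
Lemma minor_realization : exists w,
  (forall i, w (i + N) = (-1) ^+ n *: w i) /\
  (forall a b u, Lambda n l a b u -> T a b u = minor_pattern w a b u).
Proof.
have slice0 b : slice 0 b = c 0 by rewrite /slice /=; case: b.
have [|a an|a b an bl|w [wN wS]] := @realization F n l slice.
- by move=> b; rewrite !slice0.
- rewrite slice0 /slice ltnn !andbF /=; case: eqP => // _.
  by rewrite -[in RHS](cN 0); congr c; lia.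
- rewrite /slice; case: ifP => [/andP[Ia Ib]|_]; last by do !case: ifP => _.
  by apply: T_neq0; rewrite /Lambda /even_sum; lia.
exists w; split=> //.
have cw r : bracket (window w r n.+1) = c r.
  have := @periodic_modz _ (fun r => bracket (window w r n.+1)) N.
  move=> -> //; last by move=> i; exact: consecutive_periodic.
  rewrite [RHS](periodic_modz cN).
  have : 0 <= (r %% N)%Z < N by rewrite /N; lia.
  case: (r %% N)%Z => // k /andP[_]; rewrite ltz_nat => kN.
  (* k <= n + 1 is read on the side b = 0, k > n + 1 on the side a = n + 1. *)
  have [kn|nk] := leqP k n.+1.
    rewrite -(two_block_contiguous w k kn).
    have -> : k%:Z + (n.+1 - k)%N%:Z = (n.+1 + 0)%N%:Z by lia.
    by rewrite wS // /slice andbF.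
  have := wS n.+1 (k - n.+1)%N (leqnn _).
  rewrite /two_block subnn subnKC ?(ltnW nk) // => -> //; last by lia.
  rewrite /slice ltnn andbF /= eqxx subnKC ?(ltnW nk) //.
  by case: eqP => //; lia.
apply: spread.
- move=> b u bl ev; rewrite Ttop // /minor_pattern /two_block subn0 cats0 cw.
  by congr c; move: ev; rewrite /even_sum; lia.
- move=> b u bl ev; rewrite Tbot // /minor_pattern /two_block subnn cw.
  by congr c; move: ev; rewrite /even_sum; lia.
- move=> a u an ev; rewrite Tleft // /minor_pattern.
  rewrite -cw -(@two_block_contiguous _ _ w _ a); last by lia.
  by congr two_block; move: ev; rewrite /even_sum; lia.
- move=> a u an ev; rewrite Tright // /minor_pattern.
  rewrite -(two_block_rotate wN); last by lia.
  rewrite -cN -cw -(@two_block_contiguous _ _ w _ (n.+1 - a)); last by lia.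
  by congr two_block; move: ev; rewrite /even_sum /N; lia.
- move=> a b an bl; rewrite /minor_pattern.
  have := wS a b; rewrite /slice an bl /= => <-; try lia.
  by congr two_block; lia.
move=> a b u L P1 P2 P3 P4.
have [Ia Ib] : (1 <= a <= n)%N /\ (1 <= b <= l)%N by case/and3P: L.
have ev : (2 %| a%:Z + b%:Z + u + 1)%Z by case/and3P: L; rewrite /even_sum addrA.
have Mw : minor_pattern w a b (u - 1) * minor_pattern w a b (u + 1) =
    T a b (u - 1) * T a b (u + 1).
  rewrite Tsys // P1 P2 P3 P4 /minor_pattern.
  set p := ((u - 1 + a%:Z - b%:Z) %/ 2)%Z + 1.
  set q := ((u - 1 - a%:Z + b%:Z) %/ 2)%Z + n%:Z + 2.
  have := two_block_plucker w p q Ia.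
  by congr (_ = _); [congr (_ * _)|congr (_ * _ + _ * _)];
    congr two_block; rewrite /p /q; lia.
have Tm : T a b (u - 1) != 0.
  by apply: T_neq0; rewrite /Lambda /even_sum; lia.
have Tp : T a b (u + 1) != 0 by apply: T_neq0.
by split=> E; rewrite -E in Mw; [apply: (mulfI Tm)|apply: (mulIf Tp)].
Qed.

(** The two sides are brackets of the same two blocks, in opposite orders and
    with the first block moved by N. *)
Lemma half_period a b u : Lambda n l a b u ->
  T a b u = T (n.+1 - a)%N (l.+1 - b)%N (u + n%:Z + l%:Z + 2).
Proof.
move=> L; have [w [wN wT]] := minor_realization.
have /and3P[Ia Ib] := L; rewrite /even_sum => ev.
rewrite !wT //; last by rewrite /Lambda /even_sum; lia.
rewrite /minor_pattern -(two_block_rotate wN); last by lia.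
by congr two_block; rewrite /N; lia.
Qed.
End HalfPeriod.

(** * Positivity *)

Section Positive.
Variables (R : comNzRingType) (F : fieldType) (S : numDomainType).
Variables (phi : {rmorphism R -> F}) (v : {rmorphism R -> S}).
Hypothesis phi_inj : injective phi.

(** Some representative p / q of x has a positive value at the specialization
    v. The representative is quantified because v need not extend to F. *)
Definition positive (x : F) := exists p q : R,
  [/\ 0 < v p, 0 < v q & x = phi p / phi q].

Lemma rmorph_pos_neq0 p : 0 < v p -> phi p != 0.
Proof.
by apply: contraTneq; rewrite -(rmorph0 phi) => /phi_inj->; rewrite rmorph0 ltxx.
Qed.

Lemma positive_neq0 x : positive x -> x != 0.
Proof.
by case=> p [q [p0 q0 ->]]; rewrite mulf_neq0 ?invr_eq0 ?rmorph_pos_neq0.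
Qed.

Lemma positiveD x y : positive x -> positive y -> positive (x + y).
Proof.
case=> p [q [p0 q0 ->]] [p' [q' [p'0 q'0 ->]]].
exists (p * q' + p' * q), (q * q'); rewrite rmorphD !rmorphM; split.
- by rewrite addr_gt0 // mulr_gt0.
- by rewrite mulr_gt0.
- by rewrite addf_div ?rmorph_pos_neq0 // rmorphD !rmorphM.
Qed.

Lemma positiveM x y : positive x -> positive y -> positive (x * y).
Proof.
case=> p [q [p0 q0 ->]] [p' [q' [p'0 q'0 ->]]].
exists (p * p'), (q * q'); rewrite !rmorphM !mulr_gt0 //; split=> //.
by rewrite mulf_div.
Qed.

Lemma positiveV x : positive x -> positive x^-1.
Proof. by case=> p [q [p0 q0 ->]]; exists q, p; rewrite invf_div. Qed.

Lemma positive_factor x y : positive x -> positive (x * y) -> positive y.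
Proof.
move=> px pxy; rewrite -[y](mulKf (positive_neq0 px)).
exact: positiveM (positiveV px) pxy.
Qed.

Lemma positive_rmorph p : 0 < v p -> positive (phi p).
Proof. by exists p, 1; rewrite !rmorph1 ltr01 divr1. Qed.

Lemma positive1 : positive 1.
Proof. by rewrite -(rmorph1 phi); apply: positive_rmorph; rewrite rmorph1 ltr01. Qed.
End Positive.

(** The specialization sets every indeterminate to 1. *)
Definition Kpos n l (x : K n l) : Prop :=
  @positive {mpoly rat[#|{: indet n l}|]} (K n l) rat
    (@tofrac _) (meval (fun=> 1)) x.

Lemma tofrac_inj (R : idomainType) : injective (@tofrac R).
Proof. by move=> p q /eqP; rewrite tofrac_eq => /eqP. Qed.

Lemma Kpos_gen n l (v : indet n l) : Kpos (gen v).
Proof. by apply: positive_rmorph; rewrite /= mevalXU ltr01. Qed.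

Lemma Kpos_Fcoef n l r : Kpos (Fcoef n l r).
Proof.
case: r => [[|r]|r] /=; [exact: positive1| |exact: positive1].
by case: insubP => [i _ _|_]; [exact: Kpos_gen|exact: positive1].
Qed.

Lemma Kpos_neq0 n l (x : K n l) : Kpos x -> x != 0.
Proof. exact: positive_neq0 (@tofrac_inj _) _. Qed.

Lemma Fcoef_out n l (r : nat) : (n < r)%N -> Fcoef n l r%:Z = 1.
Proof. by case: r => // r nr; rewrite /Fcoef insubF //; lia. Qed.

(** * Spiral boundary conditions *)

Section Cyclic.
Variables n l : nat.
Let N : int := (n + l + 2)%N%:Z.
(** The coefficients read cyclically: F_0, ..., F_(n+1), 1, ..., 1. *)
Definition Fcyc (i : int) : K n l := Fcoef n l (i %% N)%Z.

Lemma Fcyc_periodic i : Fcyc (i + N) = Fcyc i.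
Proof. by rewrite /Fcyc modzDr. Qed.

(** Each side of the boundary, reindexed by i = u / 2 + const, satisfies these
    three clauses: this is the spiral. *)
Lemma eq_Fcyc (f : int -> K n l) :
  (forall i, [/\ f (i + N) = f i,
     0 <= i <= n%:Z + 1 -> f i = Fcoef n l i
   & n%:Z + 1 <= i <= N -> f i = 1]) ->
  forall i, f i = Fcyc i.
Proof.
move=> fP i; have fN j : f (j + N) = f j by case: (fP j).
rewrite (periodic_modz fN) /Fcyc.
have : 0 <= (i %% N)%Z < N by rewrite /N; lia.
case: (i %% N)%Z => // k kN; have [_ fF f1] := fP k.
have [kn|nk] := leqP k n; first by rewrite fF //; lia.
by rewrite f1 ?Fcoef_out // ?/N; lia.
Qed.

Variable T : nat -> nat -> int -> K n l.
Hypothesis B : spiral_boundary T.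

Lemma spiral_top b u : (1 <= b <= l)%N -> even_sum 0 b u ->
  T 0%N b u = Fcyc ((u - b%:Z + 2) %/ 2)%Z.
Proof.
move=> I; rewrite /even_sum => ev; case: B => _ /(_ b _ I) bd _ _.
rewrite -(@eq_Fcyc (fun i => T 0%N b (2 * i - 2 + b%:Z))) => [|i].
  by congr (T _ _ _); lia.
have [|per bF b1] := bd (2 * i - 2 + b%:Z); first by rewrite /even_sum; lia.
split=> [|ir|ir]; last by apply: b1; lia.
- by rewrite -per /period /N; congr (T _ _ _); lia.
- by rewrite bF; [congr Fcoef|]; lia.
Qed.

Lemma spiral_bottom b u : (1 <= b <= l)%N -> even_sum n.+1 b u ->
  T n.+1 b u = Fcyc ((u + n%:Z + b%:Z + 3) %/ 2)%Z.
Proof.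
move=> I; rewrite /even_sum => ev; case: B => /(_ b _ I) bd _ _ _.
rewrite -(@eq_Fcyc (fun i => T n.+1 b (2 * i - 3 - n%:Z - b%:Z))) => [|i].
  by congr (T _ _ _); lia.
have [|per bF b1] := bd (2 * i - 3 - n%:Z - b%:Z); first by rewrite /even_sum; lia.
split=> [|ir|ir]; last by apply: b1; lia.
- by rewrite -per /period /N; congr (T _ _ _); lia.
- by rewrite bF; [congr Fcoef|]; lia.
Qed.

Lemma spiral_left a u : (1 <= a <= n)%N -> even_sum a 0 u ->
  T a 0%N u = Fcyc ((u + a%:Z + 2) %/ 2)%Z.
Proof.
move=> I; rewrite /even_sum => ev; case: B => _ _ _ /(_ a _ I) bd.
rewrite -(@eq_Fcyc (fun i => T a 0%N (2 * i - 2 - a%:Z))) => [|i].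
  by congr (T _ _ _); lia.
have [|per bF b1] := bd (2 * i - 2 - a%:Z); first by rewrite /even_sum; lia.
split=> [|ir|ir]; last by apply: b1; lia.
- by rewrite -per /period /N; congr (T _ _ _); lia.
- by rewrite bF; [congr Fcoef|]; lia.
Qed.

Lemma spiral_right a u : (1 <= a <= n)%N -> even_sum a l.+1 u ->
  T a l.+1 u = Fcyc ((u - a%:Z - l%:Z + 1) %/ 2)%Z.
Proof.
move=> I; rewrite /even_sum => ev; case: B => _ _ /(_ a _ I) bd _.
rewrite -(@eq_Fcyc (fun i => T a l.+1 (2 * i - 1 + a%:Z + l%:Z))) => [|i].
  by congr (T _ _ _); lia.
have [|per bF b1] := bd (2 * i - 1 + a%:Z + l%:Z); first by rewrite /even_sum; lia.
split=> [|ir|ir]; last by apply: b1; lia.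
- by rewrite -per /period /N; congr (T _ _ _); lia.
- by rewrite bF; [congr Fcoef|]; lia.
Qed.

(** The recursion produces values from the indeterminates and 1 by sums,
    products and quotients only. *)
Lemma spiral_positive : T_system T -> initial_variables T ->
  forall a b u, Lambda n l a b u -> Kpos (T a b u).
Proof.
move=> Tsys Tinit; apply: spread.
- by move=> b u bl ev; rewrite spiral_top //; exact: Kpos_Fcoef.
- by move=> b u bl ev; rewrite spiral_bottom //; exact: Kpos_Fcoef.
- by move=> a u an ev; rewrite spiral_left //; exact: Kpos_Fcoef.
- by move=> a u an ev; rewrite spiral_right //; exact: Kpos_Fcoef.
- case=> // a [//|b] an bl; rewrite (Tinit (Ordinal an) (Ordinal bl)).
  exact: Kpos_gen.
move=> a b u L P1 P2 P3 P4.
have : Kpos (T a b (u - 1) * T a b (u + 1)).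
  by rewrite Tsys //; apply: (positiveD (@tofrac_inj _)); apply: positiveM.
by split=> P; apply: (positive_factor (@tofrac_inj _) P) => //; rewrite mulrC.
Qed.
End Cyclic.

(** * Half-periodicity *)

Theorem theorem2p2 (n l : nat) (hn : (1 <= n)%N) (hl : (1 <= l)%N)
    (T : nat -> nat -> int -> K n l)
    (hT : T_system T)
    (hB : spiral_boundary T)
    (hX : initial_variables T) :
  (forall (a b : nat) (u : int), Lambda n l a b u ->
     T a b u = T (n.+1 - a)%N (l.+1 - b)%N (u + n%:Z + l%:Z + 2))
  /\ (forall (a b : nat) (u : int), Lambda n l a b u ->
     T a b u = T a b (u + 2 * (n%:Z + l%:Z + 2))).
Proof.
have half a b u : Lambda n l a b u ->
    T a b u = T (n.+1 - a)%N (l.+1 - b)%N (u + n%:Z + l%:Z + 2).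
  apply: (@half_period _ n l (@Fcyc n l)) => //.
  - exact: Fcyc_periodic.
  - by move=> i; apply/Kpos_neq0/Kpos_Fcoef.
  - by move=> a' b' u' L; apply/Kpos_neq0/spiral_positive.
  - exact: spiral_top.
  - exact: spiral_bottom.
  - exact: spiral_left.
  - exact: spiral_right.
split=> // a b u L; have /and3P[Ia Ib] := L; rewrite /even_sum => ev.
rewrite half // half; last by rewrite /Lambda /even_sum; lia.
by congr (T _ _ _); lia.
Qed.
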